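(* For any $x \in \mathbb{R}_{+}^{m}$, the compliance $$\pi(x) = \sup_{u \in \mathbb{R}^{n}} \{\, 2 f^{\top} u - u^{\top} K(x) u \;\mid\; C_{\mathrm{n}} u \le g \,\}$$ coincides with the optimal value of the following optimization problem: $$\begin{aligned} \text{Minimize}\quad & \sum_{e=1}^{m} w_{e} - 2 g^{\top} r \\ \text{subject to}\quad & w_{e} x_{e} \ge \frac{l_{e}}{E} q_{e}^{2}, \qquad e=1,\dots,m, \\ & \sum_{e=1}^{m} q_{e} b_{e} = f + C_{\mathrm{n}}^{\top} r, \\ & r \le 0. \end{aligned}$$ Here, $w_{1},\dots,w_{m} \in \mathbb{R}$, $q_{1},\dots,q_{m} \in \mathbb{R}$, and $r \in \mathbb{R}^{c}$ are the variables to be optimized, and the optimal value is defined to be $+\infty$ if this minimization problem is infeasible. (Since the maximization problem defining $\pi(x)$ is feasible, $\pi(x) > -\infty$ for all $x \in \mathbb{R}_{+}^{m}$.)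
   Context: Setting (truss with frictionless unilateral contact). Let $m$, $n$, $c$ be positive integers (numbers of truss members, displacement degrees of freedom, and contact candidate nodes). The data are: constant vectors $b_{e} \in \mathbb{R}^{n}$ ($e=1,\dots,m$); member lengths $l_{e} > 0$ ($e=1,\dots,m$); the Young modulus $E > 0$; an external load vector $f \in \mathbb{R}^{n}$; a constant matrix $C_{\mathrm{n}} \in \mathbb{R}^{c \times n}$ (consisting of the unit inner normal vectors of the obstacle surface); and the vector of initial gaps $g = (g_{1},\dots,g_{c})^{\top} \in \mathbb{R}^{c}$ with $g_{j} \ge 0$ for all $j$. For a vector of member cross-sectional areas $x = (x_1,\dots,x_m)^{\top}$, the stiffness matrix is $$K(x) = \sum_{e=1}^{m} \frac{E}{l_{e}} x_{e} b_{e} b_{e}^{\top}.$$ $\mathbb{R}_{+}^{m}$ is the nonnegative orthant; inequalities between vectors are componentwise.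
   Formalization: The constraint w_e ≥ 0 is added to the minimization problem: it is implied when x_e > 0, but when some x_e = 0 and the problem is feasible, w_e would otherwise be free and the optimal value would be −∞, while π(x) > −∞. *)

(* Defs.v *)
From mathcomp Require Import all_boot all_order all_algebra.
From mathcomp Require Import all_classical all_reals ereal.

Set Implicit Arguments.
Unset Strict Implicit.
Unset Printing Implicit Defensive.

Import Order.TTheory GRing.Theory Num.Theory.

Local Open Scope classical_set_scope.
Local Open Scope ring_scope.

(* A column vector v has entries v i 0, and a 1 x 1 matrix product such as
   f^T *m u is turned into a scalar by taking its entry 0 0. *)

Definition lecv (R : realType) (k : nat) (u v : 'cV[R]_k) : Prop :=
  forall i, u i 0 <= v i 0.

Definition stiffness (R : realType) (m n : nat) (E : R) (l : 'I_m -> R)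
    (b : 'I_m -> 'cV[R]_n) (x : 'cV[R]_m) : 'M[R]_n :=
  \sum_(e < m) (E / l e * x e 0) *: (b e *m (b e)^T).

(* The supremum is taken in \bar R, hence may be +oo. *)
Definition compliance (R : realType) (m n c : nat) (E : R) (l : 'I_m -> R)
    (b : 'I_m -> 'cV[R]_n) (f : 'cV[R]_n) (Cn : 'M[R]_(c, n)) (g : 'cV[R]_c)
    (x : 'cV[R]_m) : \bar R :=
  ereal_sup [set (2 * (f^T *m u) 0 0
                  - (u^T *m stiffness E l b x *m u) 0 0)%:E
            | u in [set u : 'cV[R]_n | lecv (Cn *m u) g]].

(* The inequality w_e x_e >= (l_e / E) q_e^2 is a rotated second-order cone
   constraint, equivalently (for x_e >= 0)
     w_e + x_e >= || (w_e - x_e, 2 sqrt (l_e / E) q_e) ||,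
   and hence comes with w_e >= 0.  That sign condition is implied by the
   inequality when x_e > 0; when x_e = 0 the inequality alone would leave w_e
   free, and the infimum would be -oo as soon as the problem is feasible. *)
Definition feasible (R : realType) (m n c : nat) (E : R) (l : 'I_m -> R)
    (b : 'I_m -> 'cV[R]_n) (f : 'cV[R]_n) (Cn : 'M[R]_(c, n))
    (x w q : 'cV[R]_m) (r : 'cV[R]_c) : Prop :=
  [/\ forall e, 0 <= w e 0,
      forall e, w e 0 * x e 0 >= l e / E * q e 0 ^+ 2,
      \sum_(e < m) q e 0 *: b e = f + Cn^T *m r
    & lecv r 0].

(* Infimum in \bar R: it equals +oo when no (w, q, r) is feasible. *)
Definition min_value (R : realType) (m n c : nat) (E : R) (l : 'I_m -> R)
    (b : 'I_m -> 'cV[R]_n) (f : 'cV[R]_n) (Cn : 'M[R]_(c, n)) (g : 'cV[R]_c)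
    (x : 'cV[R]_m) : \bar R :=
  ereal_inf [set (\sum_(e < m) p.1.1 e 0 - 2 * (g^T *m p.2) 0 0)%:E
            | p in [set p : 'cV[R]_m * 'cV[R]_m * 'cV[R]_c
                   | feasible E l b f Cn x p.1.1 p.1.2 p.2]].

(* Main.v *)
Require Import Defs.
From mathcomp Require Import all_boot all_order all_algebra.
From mathcomp Require Import all_classical all_reals ereal.
From mathcomp Require Import ring lra.

(** The compliance is the value of a convex quadratic program: maximize the
concave function 2 f.u - u.Ku over the polyhedron Cu <= g.  The minimization
problem is its Lagrangian dual, with -r as the multiplier of Cu <= g and with
w_e, q_e as member energies and forces.

The dual value is at least the compliance ([weak_duality]): equilibrium
turns f.u into the work of the member forces plus a contact term of known
sign, and then the bound splits into one inequality per member,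
2 q z - k z^2 <= w with k = E x_e / l_e and z = b_e.u, which is the square
(q - k z)^2 >= 0.  When the compliance is +oo this already gives equality.

When the compliance is finite, the maximum is attained ([frank_wolfe]) and
the maximizer u satisfies the KKT conditions ([kkt]): f - Ku = C^T y for some
y >= 0 complementary to the slacks.  Then r = - y, q_e = k (b_e.u) and
w_e = k (b_e.u)^2 are feasible with the same value ([strong_duality]).

Attainment is not a matter of compactness, since the polyhedron is unbounded
and K may be singular. It comes from an active-set argument. From a feasible
point, one can move inside the face of its active constraints, without
decreasing the objective, until either a point stationary on that face or a
new constraint is reached ([climb]); an endless ray would contradict
boundedness. All points stationary on the same face have the same value
([stationary_max]), so the objective is dominated on the whole polyhedron by
finitely many values, each of them attained. The multiplier comes from Farkas'
lemma applied to the cone of feasible directions. *)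

Set Implicit Arguments.
Unset Strict Implicit.
Unset Printing Implicit Defensive.

Import Order.TTheory GRing.Theory Num.Theory.

Local Open Scope ring_scope.

(** * The Euclidean inner product *)

Definition dot (R : realFieldType) (n : nat) (u v : 'cV[R]_n) : R :=
  (u^T *m v) 0 0.

Lemma dotE (R : realFieldType) n (u v : 'cV[R]_n) :
  dot u v = \sum_i u i 0 * v i 0.
Proof. by rewrite /dot mxE; apply: eq_bigr => i _; rewrite mxE. Qed.

Lemma dotC (R : realFieldType) n (u v : 'cV[R]_n) : dot u v = dot v u.
Proof. by rewrite !dotE; apply: eq_bigr => i _; rewrite mulrC. Qed.

Lemma dotDr (R : realFieldType) n (u v w : 'cV[R]_n) :
  dot u (v + w) = dot u v + dot u w.
Proof. by rewrite /dot mulmxDr mxE. Qed.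

Lemma dotZr (R : realFieldType) n (a : R) (u v : 'cV[R]_n) :
  dot u (a *: v) = a * dot u v.
Proof. by rewrite /dot -scalemxAr mxE. Qed.

Lemma dotNr (R : realFieldType) n (u v : 'cV[R]_n) : dot u (- v) = - dot u v.
Proof. by rewrite -scaleN1r dotZr mulN1r. Qed.

Lemma dot0r (R : realFieldType) n (u : 'cV[R]_n) : dot u 0 = 0.
Proof. by rewrite /dot mulmx0 mxE. Qed.

Lemma dotDl (R : realFieldType) n (u v w : 'cV[R]_n) :
  dot (v + w) u = dot v u + dot w u.
Proof. by rewrite dotC dotDr !(dotC u). Qed.

Lemma dotZl (R : realFieldType) n (a : R) (u v : 'cV[R]_n) :
  dot (a *: v) u = a * dot v u.
Proof. by rewrite dotC dotZr dotC. Qed.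

Lemma dotNl (R : realFieldType) n (u v : 'cV[R]_n) : dot (- v) u = - dot v u.
Proof. by rewrite dotC dotNr dotC. Qed.

Lemma dot_suml (R : realFieldType) n k (F : 'I_k -> 'cV[R]_n) (u : 'cV[R]_n) :
  dot (\sum_i F i) u = \sum_i dot (F i) u.
Proof.
elim/big_ind2: _ => [|x a y b <- <-|//]; first by rewrite dotC dot0r.
by rewrite dotDl.
Qed.

Lemma dot_trmx (R : realFieldType) n k (A : 'M[R]_(k, n)) u v :
  dot u (A *m v) = dot (A^T *m u) v.
Proof. by rewrite /dot trmx_mul trmxK mulmxA. Qed.

Definition dot_lin := (dotDl, dotDr, dotNl, dotNr, dotZl, dotZr).

Lemma dot_ge0 (R : realFieldType) n (u : 'cV[R]_n) : 0 <= dot u u.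
Proof. by rewrite dotE sumr_ge0 // => i _; rewrite -expr2 sqr_ge0. Qed.

Lemma dot_eq0 (R : realFieldType) n (u : 'cV[R]_n) : dot u u <= 0 -> u = 0.
Proof.
move=> le0; have /eqP : dot u u = 0 by apply/le_anti; rewrite le0 dot_ge0.
rewrite dotE psumr_eq0 => [/allP u0|i _]; last by rewrite -expr2 sqr_ge0.
apply/colP => i; rewrite mxE; apply/eqP.
by have := u0 i (mem_index_enum _); rewrite mulf_eq0 orbb.
Qed.

Lemma dot_col_tr (R : realFieldType) n k (A : 'M[R]_(k, n)) j d :
  dot (col j A^T) d = (A *m d) j 0.
Proof. by rewrite dotE mxE; apply: eq_bigr => i _; rewrite !mxE. Qed.

Lemma mulmx_colsum (R : realFieldType) n k (A : 'M[R]_(k, n)) (y : 'cV[R]_k) :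
  \sum_j y j 0 *: col j A^T = A^T *m y.
Proof.
apply/colP => i; rewrite summxE mxE; apply: eq_bigr => j _.
by rewrite !mxE mulrC.
Qed.

(** * Farkas' lemma *)

(** Bartl's algebraic proof, by induction on the number of vectors.  If the
first vector [a0] is really needed, there is [d0] with [p.d0 > 0] and
[aj.d0 <= 0] for the other [aj], hence [a0.d0 > 0].  Subtracting from each
vector the multiple of [a0] that makes it orthogonal to [d0] preserves the
implication and kills [a0], so the induction hypothesis applies; the sign of
[d0] against [p] and the [aj] makes the coefficient recovered for [a0]
nonnegative. *)
Lemma farkas (R : realFieldType) n k (a : 'I_k -> 'cV[R]_n) (p : 'cV[R]_n) :
  (forall d, (forall j, dot (a j) d <= 0) -> dot p d <= 0) ->
  exists2 y : 'I_k -> R, (forall j, 0 <= y j) & p = \sum_j y j *: a j.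
Proof.
elim: k a p => [|k IH] a p ap.
  exists (fun=> 0) => //; rewrite big_ord0.
  by apply: dot_eq0; apply: ap => -[].
have [H|/existsNP[d0 /not_implyP[a_d0 /negP]]] := pselect
    (forall d, (forall j, dot (a (lift ord0 j)) d <= 0) -> dot p d <= 0).
  have [y y0 ->] := IH _ _ H.
  exists (fun j => if unlift ord0 j is Some i then y i else 0) => [j|].
    by case: unliftP => [i|] _.
  rewrite big_ord_recl unlift_none scale0r add0r.
  by apply: eq_bigr => j _; rewrite liftK.
rewrite -ltNge => p_d0.
pose s := dot (a ord0) d0.
have s0 : 0 < s.
  rewrite ltNge; apply/negP => s_le0; suff : dot p d0 <= 0 by lra.
  by apply: ap => j; case: (unliftP ord0 j) => [i|] ->.
(* [proj] is adjoint to the projection of [d] along [d0] onto the orthogonal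
   of [a0], which is how the hypothesis on [a] passes to [proj \o a]. *)
pose proj (z : 'cV[R]_n) := z - (dot z d0 / s) *: a ord0.
have dot_proj z d : dot (proj z) d = dot z (d - (dot (a ord0) d / s) *: d0).
  by rewrite /proj !dot_lin; ring.
have [|y y0 p_y] := IH (fun j => proj (a (lift ord0 j))) (proj p).
  move=> d ad; rewrite dot_proj; apply: ap => j.
  case: (unliftP ord0 j) => [i|] ->; first by rewrite -dot_proj.
  by rewrite !dot_lin -/s divfK ?gt_eqF // subrr.
pose y1 := (dot p d0 - \sum_j y j * dot (a (lift ord0 j)) d0) / s.
exists (fun j => if unlift ord0 j is Some i then y i else y1) => [j|].
  case: unliftP => [i|] _ //; rewrite divr_ge0 ?(ltW s0) // subr_ge0.
  apply: le_trans (ltW p_d0); rewrite -oppr_ge0 -sumrN sumr_ge0 // => i _.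
  by rewrite -mulrN mulr_ge0 // oppr_ge0.
rewrite big_ord_recl unlift_none.
under eq_bigr do rewrite liftK.
have -> : p = proj p + (dot p d0 / s) *: a ord0 by rewrite subrK.
rewrite p_y; under [X in X + _]eq_bigr do rewrite /proj scalerBr scalerA mulrA.
rewrite sumrB -scaler_suml -mulr_suml /y1 mulrBl scalerBl.
by rewrite addrAC -addrA addrC.
Qed.

(** * Concave quadratic objectives *)

Definition psd (R : realFieldType) n (K : 'M[R]_n) :=
  K^T = K /\ forall d, 0 <= dot d (K *m d).

Lemma psd_sym (R : realFieldType) n (K : 'M[R]_n) u v :
  psd K -> dot u (K *m v) = dot v (K *m u).
Proof. by case=> Ks _; rewrite dot_trmx Ks dotC. Qed.

(** Along [d + t *: K d] the form is [2 t |Kd|^2 + O(t^2)], which would be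
negative for some small negative [t] unless [K d = 0]. *)
Lemma psd_ker (R : realFieldType) n (K : 'M[R]_n) d :
  psd K -> dot d (K *m d) = 0 -> K *m d = 0.
Proof.
move=> Kp d0; apply: dot_eq0; rewrite leNgt; apply/negP.
set z := K *m d; set a := dot z z => a_gt0; set q := dot z (K *m z).
have q_ge0 : 0 <= q by apply: Kp.2.
(* Any sufficiently small negative [t] works; this one keeps the
   denominator positive even if [q = 0]. *)
pose t := - (a / (a + q)).
have := Kp.2 (d + t *: z).
rewrite mulmxDr -scalemxAr !dot_lin d0 (psd_sym d z Kp) -/z -/a -/q.
have -> : 0 + t * a + (t * a + t * (t * q))
    = - (a / (a + q)) ^+ 2 * (2 * a + q).
  by rewrite /t; field; lra.
suff : 0 < (a / (a + q)) ^+ 2 * (2 * a + q) by lra.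
by rewrite mulr_gt0 ?exprn_gt0 ?divr_gt0 //; lra.
Qed.

Definition qobj (R : realFieldType) n (K : 'M[R]_n) (f u : 'cV[R]_n) : R :=
  2 * dot f u - dot u (K *m u).

Lemma qobjD (R : realFieldType) n (K : 'M[R]_n) f u d (t : R) : psd K ->
  qobj K f (u + t *: d)
  = qobj K f u + 2 * t * dot (f - K *m u) d - t ^+ 2 * dot d (K *m d).
Proof.
move=> Kp; rewrite /qobj mulmxDr -scalemxAr !dot_lin (psd_sym u d Kp).
by rewrite (dotC (K *m u)); ring.
Qed.

(** Fredholm alternative for the row system [y *m A = v]: a vector of the
kernel of [A] not orthogonal to [v] certifies that there is no solution. *)
Lemma notin_rowspace (R : realFieldType) p q (A : 'M[R]_(p, q)) (v : 'rV[R]_q) :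
  ~~ (v <= A)%MS -> exists2 z : 'cV[R]_q, A *m z = 0 & (v *m z) 0 0 != 0.
Proof.
rewrite submxE => /matrix0Pn[i [j vj]]; exists (col j (cokermx A)).
  by rewrite colE mulmxA mulmx_coker mul0mx.
by rewrite colE mulmxA -colE mxE; rewrite ord1 in vj.
Qed.

(** On the affine space [u + ker D], the objective either has a stationary
point or grows linearly along a ray.  Parametrizing [ker D] by a matrix [N]
with rows in it, stationarity is a linear system with matrix [N K N^T]; by
Fredholm, if it has no solution some [y = N^T z] has [N K y = 0], so
[y.Ky = 0] and [K y = 0], while the gradient is not orthogonal to [y].  Then
[y] or [- y] is the ray. *)
Lemma stationary_or_ray (R : realFieldType) n k (K : 'M[R]_n) (f u : 'cV[R]_n)
    (D : 'M[R]_(k, n)) : psd K ->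
  (exists2 d, D *m d = 0 &
     forall d', D *m d' = 0 -> dot (f - K *m (u + d)) d' = 0) \/
  (exists d, [/\ D *m d = 0, K *m d = 0 & 0 < dot f d]).
Proof.
move=> Kp; pose N := kermx D^T; pose rho := f - K *m u.
have DN : D *m N^T = 0 by rewrite -[D]trmxK -trmx_mul mulmx_ker trmx0.
have kerN d : D *m d = 0 -> exists z : 'rV_n, d = N^T *m z^T.
  move=> Dd; have /submxP[z dz] : (d^T <= N)%MS.
    by apply/sub_kermxP; rewrite -trmx_mul Dd trmx0.
  by exists z; rewrite -trmx_mul -dz trmxK.
have [/submxP[z zE]|] := boolP (rho^T *m N^T <= N *m K *m N^T)%MS.
  left; exists (N^T *m z^T); first by rewrite mulmxA DN mul0mx.
  move=> d' /kerN[z' ->]; rewrite mulmxDr opprD addrA -/rho /dot linearB /=.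
  rewrite mulmxA mulmxBl zE !trmx_mul !trmxK Kp.1 !mulmxA subrr mul0mx.
  by rewrite mxE.
move=> /notin_rowspace[z z0]; rewrite -mulmxA => rz; right.
pose y := N^T *m z.
have Dy : D *m y = 0 by rewrite mulmxA DN mul0mx.
have Ky : K *m y = 0.
  apply: psd_ker => //.
  by rewrite /dot trmx_mul trmxK -mulmxA (mulmxA N) (mulmxA (N *m K)) z0
    mulmx0 mxE.
have fy : dot f y != 0.
  have -> : dot f y = dot rho y.
    by rewrite /rho !dot_lin dotC (dotC (K *m u)) (psd_sym y u Kp) Ky dot0r
      oppr0 addr0.
  exact: rz.
have [f0|f0|f0] := ltgtP 0 (dot f y); first by exists y.
- exists (- y); split; rewrite ?mulmxN ?Dy ?Ky ?oppr0 // dotNr; lra.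
- by rewrite -f0 eqxx in fy.
Qed.

(** * Active-set argument *)

(** The ratio test of the simplex method: with slacks [s] decreasing at rates
[d], either no constraint is ever violated, or constraint [j] is the first
to become active, at time [s j / d j]. *)
Lemma ratio_test (R : realFieldType) c (s d : 'I_c -> R) :
  (forall j, 0 <= s j) ->
  (forall j, d j <= 0) \/
  exists2 j, 0 < d j & forall k, s j / d j * d k <= s k.
Proof.
move=> s0.
have [/existsP[j0 dj0]|/existsPn noj] := boolP [exists j, 0 < d j]; last first.
  by left => j; rewrite leNgt.
right; case: (@arg_minP _ _ _ j0 (fun j => 0 < d j) (fun j => s j / d j) dj0).
move=> j dj jmin; exists j => // k; have [dk|dk] := ltP 0 (d k).
  by rewrite -ler_pdivlMr // jmin.
by apply: le_trans (s0 k); rewrite mulr_ge0_le0 // divr_ge0 // ltW.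
Qed.

Section QuadraticProgram.
Variables (R : realFieldType) (n c : nat) (K : 'M[R]_n) (f : 'cV[R]_n).
Variables (C : 'M[R]_(c, n)) (g : 'cV[R]_c).
Hypothesis Kp : psd K.
Implicit Types u v d : 'cV[R]_n.

Let P (u : 'cV[R]_n) := forall j, (C *m u) j 0 <= g j 0.
Let F := qobj K f.

(** Feasible critical points of the objective on the affine space cut out by
[A]; [f - K u] is half of the gradient. *)
Definition stationary (A : {set 'I_c}) (u : 'cV[R]_n) :=
  [/\ P u, forall j, j \in A -> (C *m u) j 0 = g j 0
    & forall d, (forall j, j \in A -> (C *m d) j 0 = 0) ->
        dot (f - K *m u) d = 0].

(** By concavity a stationary point maximizes the objective on its affine
space; by symmetry, all points stationary on the same face have the same
value. *)
Lemma stationary_max A u v : stationary A u -> stationary A v -> F v <= F u.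
Proof.
move=> [_ uA ustat] [_ vA _].
have -> : v = u + 1 *: (v - u) by rewrite scale1r addrC subrK.
rewrite /F qobjD // ustat => [|j jA]; last first.
  by rewrite mulmxBr mxE [X in _ + X]mxE uA // vA // subrr.
by have := Kp.2 (v - u); lra.
Qed.


Lemma segmentE u d t j :
  (C *m (u + t *: d)) j 0 = (C *m u) j 0 + t * (C *m d) j 0.
Proof. by rewrite mulmxDr -scalemxAr !mxE. Qed.

(** Induction on the number of constraints outside [A].  The objective does not
decrease from [u] toward a stationary point of the affine hull of its face,
nor along an ascent ray of it.  Following that direction, the only
obstacle is a constraint outside [A] becoming active, which enlarges [A].
If nothing stops the motion, the stationary point is feasible in the
first case, and the bound [M] is violated in the second. *)
Lemma climb M (A : {set 'I_c}) u :
  (forall v, P v -> F v <= M) -> P u ->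
  (forall j, j \in A -> (C *m u) j 0 = g j 0) ->
  exists A' u', stationary A' u' /\ F u <= F u'.
Proof.
move=> FM; have [k] := ubnP #|~: A|; elim: k => // k IH in A u *.
rewrite ltnS => cardA uP uA.
pose s j := g j 0 - (C *m u) j 0.
have s0 j : 0 <= s j by rewrite subr_ge0.
(* [D] keeps the rows of [C] in [A] and zeroes the others: its kernel is the
   direction of the face. *)
pose D := diag_mx (\row_j (j \in A)%:R) *m C.
have DE d j : (D *m d) j 0 = (j \in A)%:R * (C *m d) j 0.
  by rewrite /D -mulmxA mul_diag_mx !mxE.
have kerD d : D *m d = 0 <-> forall j, j \in A -> (C *m d) j 0 = 0.
  split=> [Dd j jA|Cd].
    by have := DE d j; rewrite Dd mxE jA mul1r => <-.
  apply/colP => j; rewrite DE [RHS]mxE.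
  by case: (boolP (j \in A)) => [/Cd ->|_]; rewrite ?mulr0 ?mul0r.
(* What happens when constraint [j] stops the motion along [d]. *)
have hit d j : D *m d = 0 -> 0 < (C *m d) j 0 ->
    (forall i, s j / (C *m d) j 0 * (C *m d) i 0 <= s i) ->
    F u <= F (u + (s j / (C *m d) j 0) *: d) ->
    exists A' u', stationary A' u' /\ F u <= F u'.
  move=> /kerD Dd dj tP Fle; set t := s j / _ in tP Fle.
  have jA : j \notin A by apply/negP => /Dd dj0; rewrite dj0 ltxx in dj.
  have [||i|A' [u' [stat' Fle']]] := IH (j |: A) (u + t *: d).
  - apply: leq_trans cardA; apply: proper_card; rewrite properC.
    by apply/properP; split; [exact: subsetU1|exists j; rewrite ?setU11].
  - by move=> i; rewrite segmentE -lerBrDl tP.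
  - rewrite segmentE in_setU1 => /orP[/eqP ->|iA]; last first.
      by rewrite uA // Dd // mulr0 addr0.
    by rewrite /t divfK ?gt_eqF // /s addrC subrK.
  - by exists A', u'; split=> //; exact: le_trans Fle'.
have [[d Dd stat]|[d [Dd Kd fd]]] := stationary_or_ray f u D Kp.
- have grad_d : dot (f - K *m u) d = dot d (K *m d).
    have := stat d Dd; rewrite mulmxDr !dot_lin (dotC (K *m d)); lra.
  have Fd t : F (u + t *: d) = F u + t * (2 - t) * dot d (K *m d).
    by rewrite /F qobjD // grad_d; ring.
  have done_d : (forall j, (C *m d) j 0 <= s j) ->
      exists A' u', stationary A' u' /\ F u <= F u'.
    move=> dP; exists A, (u + 1 *: d); split; last first.
      by rewrite Fd lerDl mulr_ge0 ?Kp.2 //; lra.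
    split=> [j|j jA|d' d'A]; rewrite ?segmentE ?mul1r ?scale1r.
    + by rewrite -lerBrDl dP.
    + by rewrite uA // (iffLR (kerD d) Dd) // addr0.
    + by apply: stat; apply/kerD.
  have [d0|[j dj tP]] := ratio_test (fun j => (C *m d) j 0) s0.
    by apply: done_d => j; exact: le_trans (d0 j) (s0 j).
  have t0 : 0 <= s j / (C *m d) j 0 by rewrite divr_ge0 // ltW.
  (* The stationary point is reached at time 1, so only an earlier obstacle
     matters. *)
  have [t1|t1] := lerP 1 (s j / (C *m d) j 0).
    apply: done_d => i; have [di|di] := leP ((C *m d) i 0) 0.
      exact: le_trans (s0 i).
    by apply: le_trans (tP i); rewrite ler_peMl // ltW.
  apply: (hit d j) => //; rewrite Fd lerDl mulr_ge0 ?Kp.2 // mulr_ge0 //; lra.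
- have Fd t : F (u + t *: d) = F u + 2 * t * dot f d.
    rewrite /F qobjD // !dot_lin Kd dot0r (dotC (K *m u)) (psd_sym d u Kp).
    by rewrite Kd dot0r; ring.
  have [d0|[j dj tP]] := ratio_test (fun j => (C *m d) j 0) s0; last first.
    apply: (hit d j) => //; rewrite Fd lerDl mulr_ge0 ?(ltW fd) //.
    by rewrite mulr_ge0 // divr_ge0 // ltW.
  (* Chosen so that the objective equals [M + 1] at time [t]. *)
  pose t := (M - F u + 1) / (2 * dot f d).
  have Fu := FM _ uP.
  have t0 : 0 <= t by rewrite divr_ge0 //; lra.
  have := FM (u + t *: d); rewrite Fd.
  have -> : 2 * t * dot f d = M - F u + 1 by rewrite /t; field; rewrite gt_eqF.
  have Pt : P (u + t *: d).
    move=> j; rewrite segmentE.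
    by have := mulr_ge0_le0 t0 (d0 j); have := uP j; lra.
  by move=> /(_ Pt); lra.
Qed.

(** A quadratic objective that is bounded above on a polyhedron attains its
maximum.  By [climb], every value is dominated by a value at a stationary
point, and these depend on the face only, so it suffices to compare one
representative per face. *)
Lemma frank_wolfe M u0 : P u0 -> (forall v, P v -> F v <= M) ->
  exists2 u, P u & forall v, P v -> F v <= F u.
Proof.
move=> u0P FM.
have /choice[v vP] : forall A : {set 'I_c}, exists w,
    P w /\ ((exists u, stationary A u) -> stationary A w).
  move=> A; have [[u ustat]|noU] := pselect (exists u, stationary A u).
    by exists u; split=> //; case: ustat.
  by exists u0.
(* Faces without stationary point are represented by [u0], which is harmless
   as it is feasible. *)
pose B := [arg max_(A > finset.set0) F (v A)]%O.
have Bmax A : F (v A) <= F (v B) by rewrite /B; case: arg_maxP => // i _; apply.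
exists (v B) => [|u uP]; first by case: (vP B).
have [|A [u' [stat Fle]]] := @climb M finset.set0 u FM uP.
  by move=> j; rewrite finset.inE.
apply: le_trans Fle (le_trans _ (Bmax A)).
by apply: (stationary_max _ stat); apply: (vP A).2; exists u'.
Qed.

(** At a maximizer, every direction that does not violate the active
constraints to first order is feasible for a short time, because
constraints are linear; so the gradient makes no acute angle with it, and
Farkas' lemma puts the gradient in the cone of the active normals. *)
Lemma kkt u : P u -> (forall v, P v -> F v <= F u) ->
  exists y : 'cV[R]_c, [/\ forall j, 0 <= y j 0, f - K *m u = C^T *m y
    & forall j, y j 0 * (C *m u) j 0 = y j 0 * g j 0].
Proof.
move=> uP umax.
pose act j := (C *m u) j 0 == g j 0.
(* Zeroing the inactive normals keeps the index type ['I_c] and makes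
   complementarity automatic. *)
pose a j := (act j)%:R *: col j C^T.
have aE j d : dot (a j) d = (act j)%:R * (C *m d) j 0.
  by rewrite dotZl dot_col_tr.
pose s j := g j 0 - (C *m u) j 0.
have s0 j : 0 <= s j by rewrite subr_ge0.
have [d ad|y y0 grad] := @farkas _ _ _ a (f - K *m u).
  rewrite leNgt; apply/negP; set G := dot _ d => G0.
  have [T T0 TP] : exists2 T, 0 < T & forall t, 0 < t <= T -> P (u + t *: d).
    have [d0|[j dj tP]] := ratio_test (fun j => (C *m d) j 0) s0.
      exists 1 => // t /andP[t0 _] j; rewrite segmentE -lerBrDl.
      by apply: le_trans (s0 j); rewrite mulr_ge0_le0 // ltW.
    exists (s j / (C *m d) j 0) => [|t /andP[t0 tT] i].
      rewrite divr_gt0 // lt_def s0 andbT subr_eq0; apply/negP => gj.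
      by have := ad j; rewrite aE /act eq_sym gj mul1r leNgt dj.
    rewrite segmentE -lerBrDl; have [di|di] := leP ((C *m d) i 0) 0.
      by apply: le_trans (s0 i); rewrite mulr_ge0_le0 // ltW.
    by apply: le_trans (tP i); rewrite ler_wpM2r // ltW.
  set q := dot d (K *m d).
  have q0 : 0 <= q by exact: Kp.2.
  have Tq : 0 <= T * q by rewrite mulr_ge0 // ltW.
  (* A step at most [T] and below [2 G / q], so that the linear gain [2 t G]
     exceeds the quadratic loss [t^2 q]. *)
  pose t := T * G / (G + T * q).
  have t0 : 0 < t by rewrite divr_gt0 ?mulr_gt0 //; lra.
  have tT : t <= T by rewrite ler_pdivrMr ?ler_wpM2l ?(ltW T0) //; lra.
  have := umax _ (TP t _); rewrite t0 tT => /(_ isT).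
  rewrite /F qobjD // -/G -/q.
  have -> : t ^+ 2 * q = t * (G * (T * q / (G + T * q))).
    by rewrite /t; field; lra.
  have : T * q / (G + T * q) <= 1 by rewrite ler_pdivrMr; lra.
  move=> /(ler_wpM2l (ltW G0)) /(ler_wpM2l (ltW t0)).
  by have := mulr_gt0 t0 G0; lra.
exists (\col_j (y j * (act j)%:R)); split=> [j||j].
- by rewrite mxE mulr_ge0.
- rewrite grad -mulmx_colsum; apply: eq_bigr => j _.
  by rewrite scalerA mxE.
- rewrite mxE -!mulrA; congr (_ * _).
  by rewrite /act; case: eqP => [->|_]; rewrite ?mul0r.
Qed.

End QuadraticProgram.

(** * Duality for the truss problem *)

Section Truss.
Variables (R : realType) (m n c : nat).
Variables (b : 'I_m -> 'cV[R]_n) (l : 'I_m -> R) (E : R).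
Variables (f : 'cV[R]_n) (C : 'M[R]_(c, n)) (g : 'cV[R]_c) (x : 'cV[R]_m).
Hypotheses (l_gt0 : forall e, 0 < l e) (E_gt0 : 0 < E).
Hypothesis x_ge0 : forall e, 0 <= x e 0.

Let K := stiffness E l b x.
Let kap e := E / l e * x e 0.

Let kap_ge0 e : 0 <= kap e.
Proof. by rewrite mulr_ge0 // divr_ge0 // ltW. Qed.

Lemma stiffness_mulmx (v : 'cV[R]_n) :
  K *m v = \sum_e (kap e * dot (b e) v) *: b e.
Proof.
rewrite /K /stiffness mulmx_suml; apply: eq_bigr => e _.
rewrite -scalemxAl -mulmxA [(b e)^T *m v]mx11_scalar -/(dot (b e) v).
by rewrite mul_mx_scalar scalerA.
Qed.

Lemma dot_stiffness (u v : 'cV[R]_n) :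
  dot u (K *m v) = \sum_e kap e * dot (b e) u * dot (b e) v.
Proof.
rewrite stiffness_mulmx dotC dot_suml; apply: eq_bigr => e _.
by rewrite dotZl; ring.
Qed.

Lemma psd_stiffness : psd K.
Proof.
split=> [|d].
  rewrite /K /stiffness linear_sum /=; apply: eq_bigr => e _.
  by rewrite linearZ /= trmx_mul trmxK.
rewrite dot_stiffness sumr_ge0 // => e _.
by rewrite -mulrA -expr2 mulr_ge0 ?sqr_ge0.
Qed.

(** For [x e > 0] the left side is at most [q^2 / kap e], by completing the
square.  For [x e = 0] the cone constraint forces [q = 0]: an absent member
carries no force. *)
Lemma member_duality e (w q z : R) : 0 <= w -> l e / E * q ^+ 2 <= w * x e 0 ->
  2 * (q * z) - kap e * z * z <= w.
Proof.
rewrite /kap => w0; have := x_ge0 e; rewrite le_eqVlt => /orP[/eqP <-|x0].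
  rewrite mulr0 => q_le0; have -> : q = 0.
    apply/eqP; rewrite -sqrf_eq0; apply/eqP/le_anti; rewrite sqr_ge0 andbT.
    by rewrite -(pmulr_rle0 _ (_ : 0 < l e / E)) // divr_gt0.
  by lra.
rewrite -invf_div ler_pdivrMl ?divr_gt0 // => wq.
have kx : 0 < E / l e * x e 0 by rewrite mulr_gt0 // divr_gt0.
rewrite -(ler_pM2l kx).
have := sqr_ge0 (q - E / l e * x e 0 * z); lra.
Qed.

(** By equilibrium, [f.u] is the work of the member forces minus [r.Cu], and
[r.Cu >= r.g] since [r <= 0] and [C u <= g]; what remains is
[member_duality], summed over the members. *)
Lemma weak_duality (u : 'cV[R]_n) w q r : lecv (C *m u) g ->
  feasible E l b f C x w q r ->
  qobj K f u <= \sum_e w e 0 - 2 * dot g r.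
Proof.
move=> uP [w0 wx equil r0].
have -> : qobj K f u = 2 * (\sum_e q e 0 * dot (b e) u - dot r (C *m u))
                       - dot u (K *m u).
  have fE : f = \sum_(e < m) q e 0 *: b e - C^T *m r by rewrite equil addrK.
  rewrite /qobj {1}fE dotDl dotNl -dot_trmx dot_suml.
  by under eq_bigr do rewrite dotZl.
have rC : dot g r <= dot r (C *m u).
  rewrite !dotE; apply: ler_sum => j _; rewrite [g j 0 * _]mulrC.
  by rewrite ler_wnM2l // (le_trans (r0 j)) // mxE.
suff : 2 * (\sum_e q e 0 * dot (b e) u) - dot u (K *m u) <= \sum_e w e 0 by lra.
rewrite dot_stiffness mulr_sumr -sumrB; apply: ler_sum => e _.
exact: member_duality.
Qed.

(** The dual solution is read off the maximizer: forces and energies of the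
members displaced by [u], and reactions opposite to the KKT multiplier [y].
Stationarity [f - K u = C^T y] is then equilibrium, and complementarity
[y.g = y.Cu] gives equality of the two values. *)
Lemma strong_duality M : lecv (C *m (0 : 'cV[R]_n)) g ->
  (forall u, lecv (C *m u) g -> qobj K f u <= M) ->
  exists2 u, lecv (C *m u) g & exists w q r, feasible E l b f C x w q r /\
    \sum_e w e 0 - 2 * dot g r = qobj K f u.
Proof.
move=> P0 FM; have Kp := psd_stiffness.
have [u uP umax] := frank_wolfe Kp P0 FM.
have [y [y0 grad slack]] := kkt Kp uP umax.
exists u => //; exists (\col_e (kap e * dot (b e) u ^+ 2)).
exists (\col_e (kap e * dot (b e) u)), (- y); split.
  split=> [e|e||j].
  - by rewrite mxE mulr_ge0 ?sqr_ge0.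
  - rewrite !mxE le_eqVlt; apply/orP; left; apply/eqP.
    by rewrite /kap; field; rewrite !gt_eqF.
  - under eq_bigr do rewrite mxE.
    by rewrite -stiffness_mulmx mulmxN -grad opprB addrC subrK.
  - by rewrite !mxE oppr_le0.
have gy : dot g y = dot (f - K *m u) u.
  rewrite grad -dot_trmx !dotE; apply: eq_bigr => j _.
  by rewrite slack mulrC.
under eq_bigr do rewrite mxE expr2 mulrA.
by rewrite -dot_stiffness /qobj dotNr gy !dot_lin (dotC (K *m u)); ring.
Qed.

End Truss.

Unset Implicit Arguments.

Theorem theorem1 (R : realType) (m n c : nat)
    (hm : (0 < m)%N) (hn : (0 < n)%N) (hc : (0 < c)%N)
    (b : 'I_m -> 'cV[R]_n) (l : 'I_m -> R) (hl : forall e, 0 < l e)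
    (E : R) (hE : 0 < E) (f : 'cV[R]_n)
    (Cn : 'M[R]_(c, n)) (g : 'cV[R]_c) (hg : forall j, 0 <= g j 0)
    (x : 'cV[R]_m) (hx : forall e, 0 <= x e 0) :
  (-oo < compliance E l b f Cn g x)%E /\
  compliance E l b f Cn g x = min_value E l b f Cn g x.
Proof.
set K := stiffness E l b x.
have objE u : 2 * (f^T *m u) 0 0 - (u^T *m K *m u) 0 0 = qobj K f u.
  by rewrite /qobj /dot mulmxA.
have compl_ge u : lecv (Cn *m u) g ->
    ((qobj K f u)%:E <= compliance E l b f Cn g x)%E.
  by move=> uP; apply: ereal_sup_ubound; exists u => //; rewrite objE.
have P0 : lecv (Cn *m (0 : 'cV[R]_n)) g by move=> j; rewrite mulmx0 mxE.
have compl_gtNy : (-oo < compliance E l b f Cn g x)%E.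
  by apply: lt_le_trans (compl_ge 0 P0); rewrite ltNyr.
split=> //; apply/le_anti/andP; split.
  apply: ge_ereal_sup => _ [u uP <-]; apply: le_ereal_inf_tmp.
  move=> _ [[[w q] r] /= wqr <-]; rewrite lee_fin objE.
  exact: (weak_duality hl hE hx uP wqr).
have [->|fin] := eqVneq (compliance E l b f Cn g x) +oo%E; first exact: leey.
have [M ME] : exists M, compliance E l b f Cn g x = M%:E.
  by case: compliance fin compl_gtNy => // M _ _; exists M.
have FM u : lecv (Cn *m u) g -> qobj K f u <= M.
  by move=> /compl_ge; rewrite ME lee_fin.
have [u uP [w [q [r [wqr val]]]]] := strong_duality hl hE hx P0 FM.
apply: le_trans (compl_ge u uP); rewrite -val.
by apply: ereal_inf_lbound; exists (w, q, r).
Qed.
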